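(* For small $\varepsilon>0$ consider the distributions $p=\left(\frac12-10\varepsilon,\frac12+8\varepsilon,2\varepsilon\right)$ and $q=\left(\frac12,\frac12,0\right)$ on $\{1,2,3\}$. For each model $A\in\{\mathrm{TV},\mathrm{Hub},\mathrm{Sub}\}$ define $\varepsilon_1<\varepsilon_2$ as follows: (i) for $A=\mathrm{TV}$, fix $0<t<1/3$ and set $\varepsilon_2=\varepsilon$, $\varepsilon_1=\varepsilon-\varepsilon^{1+t}$; (ii) for $A=\mathrm{Hub}$, fix $0<t<1/2$ and set $\varepsilon_2=\frac{2\varepsilon}{1+2\varepsilon}$, $\varepsilon_1=\varepsilon_2-\varepsilon^{1+t}$; (iii) for $A=\mathrm{Sub}$, fix $0<t<1$ and set $\varepsilon_2=\frac{2\varepsilon}{1-2\varepsilon}$, $\varepsilon_1=\varepsilon_2-\varepsilon^{1+t}$. (So $\varepsilon_1=\varepsilon_2-o(\varepsilon_2)$ as $\varepsilon\to0$.) Let $\varphi_{A,\varepsilon_1,n}$ denote the $n$-sample likelihood ratio test between the $A$-least favourable distributions $(p^*_{A},q^*_{A})$ at contamination level $\varepsilon_1$: on input $(x_1,\dots,x_n)$ it outputs $0$ (deciding for $p$) if $\prod_{i=1}^n p^*_A(x_i)\ge\prod_{i=1}^n q^*_A(x_i)$, and $1$ (deciding for $q$) otherwise. Then, in each of the three models, for all sufficiently small $\varepsilon>0$ there exist distributions $P_2\in\mathcal P_A(p,\varepsilon_2)$ and $Q_2\in\mathcal P_A(q,\varepsilon_2)$ such that $$\liminf_{n\to\infty}\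 \max\Big\{\mathbb P_{P_2^{\otimes n}}(\varphi_{A,\varepsilon_1,n}=1),\ \mathbb P_{Q_2^{\otimes n}}(\varphi_{A,\varepsilon_1,n}=0)\Big\}=1.$$
   Context: With $\mathcal X$ finite, $\Delta(\mathcal X)$ the probability distributions on $\mathcal X$, and $d_{\mathrm{TV}}(p,q)=\frac12\sum_x|p(x)-q(x)|$, the uncertainty sets are $\mathcal P_{\mathrm{Hub}}(p,\eta)=\{(1-\eta)p+\eta h: h\in\Delta(\mathcal X)\}$, $\mathcal P_{\mathrm{TV}}(p,\eta)=\{p'\in\Delta(\mathcal X): d_{\mathrm{TV}}(p',p)\le\eta\}$, $\mathcal P_{\mathrm{Sub}}(p,\eta)=\{p'\in\Delta(\mathcal X): p'(x)\le(1+\eta)p(x)\ \forall x\}$. Least favourable distributions at level $\eta$. For clips $c'<1<c''$ let $L=\{i:p(i)/q(i)<c'\}$, $M=\{i:p(i)/q(i)\in[c',c'']\}$, $H=\{i:p(i)/q(i)>c''\}$ (with $p(i)/q(i)=\infty$ if $p(i)>0=q(i)$). Huber: $c',c''$ solve $c'q(L)-p(L)=\frac{\eta}{1-\eta}$ and $\frac{p(H)}{c''}-q(H)=\frac{\eta}{1-\eta}$; $p^*=(1-\eta)c'q$ on $L$, $p^*=(1-\eta)p$ on $M\cup H$; $q^*=(1-\eta)q$ on $L\cup M$, $q^*=(1-\eta)p/c''$ on $H$. TV: $c',c''$ solve $\frac{p(H)-c''q(H)}{1+c''}=\eta$ and $\frac{c'q(L)-p(L)}{1+c'}=\eta$; $p^*=\frac{c'(p+q)}{1+c'}$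 on $L$, $p^*=p$ on $M$, $p^*=\frac{c''(p+q)}{1+c''}$ on $H$; $q^*=\frac{p+q}{1+c'}$ on $L$, $q^*=q$ on $M$, $q^*=\frac{p+q}{1+c''}$ on $H$. Subtractive: $c',c''$ solve $p(H)-c''q(H)=\frac{\eta}{1+\eta}$ and $q(L)-\frac{p(L)}{c'}=\frac{\eta}{1+\eta}$; $p^*=(1+\eta)p$ on $L\cup M$, $p^*=c''(1+\eta)q$ on $H$; $q^*=\frac{1+\eta}{c'}p$ on $L$, $q^*=(1+\eta)q$ on $M\cup H$. If, with $\bar H=\{i:p(i)>0=q(i)\}$, one has $p(\bar H)>\frac{\eta}{1+\eta}$, so that no $c''$ exists, then instead $p^*=(1+\eta)p$ off $\bar H$ and $p^*(i)=(1+\eta)p(i)\big(1-\frac{\eta}{(1+\eta)p(\bar H)}\big)$ on $\bar H$, with $q^*=\frac{1+\eta}{c'}p$ on $L$ and $(1+\eta)q$ off $L$. *)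

(* Defs.v *)
From HB Require Import structures.
From mathcomp Require Import all_boot all_order all_algebra.
From mathcomp Require Import all_classical all_reals all_analysis.
Import Order.TTheory GRing.Theory Num.Theory.
Import numFieldNormedType.Exports.

Set Implicit Arguments.
Unset Strict Implicit.
Unset Printing Implicit Defensive.

Local Open Scope classical_set_scope.
Local Open Scope ring_scope.

(* Distributions on a finite set X are represented by their mass functions
   X -> R; [simplex] is Delta(X). *)
Definition simplex (R : realType) (X : finType) : set (X -> R) :=
  [set p | (forall x, 0 <= p x) /\ \sum_x p x = 1].

Definition dTV (R : realType) (X : finType) (p q : X -> R) : R :=
  2^-1 * \sum_x `|p x - q x|.

Inductive model := TV | Hub | Sub.

Definition uncertainty (R : realType) (X : finType) (A : model)
    (p : X -> R) (eta : R) : set (X -> R) :=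
  match A with
  | TV => [set p' | simplex p' /\ dTV p' p <= eta]
  | Hub => [set p' | exists2 h, simplex h &
                      forall x, p' x = (1 - eta) * p x + eta * h x]
  | Sub => [set p' | simplex p' /\ forall x, p' x <= (1 + eta) * p x]
  end.

Definition mass (R : realType) (X : finType) (p : X -> R) (S : {set X}) : R :=
  \sum_(i in S) p i.

(* When p i = q i = 0 the ratio is undefined on paper; here it is 0. The value
   is irrelevant: such an i has no mass and all formulas below give 0 at i. *)
Definition ratio (R : realType) (X : finType) (p q : X -> R) (i : X) : \bar R :=
  if (0 < p i) && (q i == 0) then +oo%E else (p i / q i)%:E.

Definition lowset (R : realType) (X : finType) (p q : X -> R) (c : R) : {set X} :=
  [set i | (ratio p q i < c%:E)%E].

Definition highset (R : realType) (X : finType) (p q : X -> R) (c : R) : {set X} :=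
  [set i | (c%:E < ratio p q i)%E].

Definition infset (R : realType) (X : finType) (p q : X -> R) : {set X} :=
  [set i | (0 < p i) && (q i == 0)].

Definition piecewise (R : realType) (X : finType) (L H : {set X})
    (l m h : X -> R) (f : X -> R) : Prop :=
  forall i, f i = if i \in L then l i else if i \in H then h i else m i.

Definition lfd_TV (R : realType) (X : finType) (eta : R)
    (p q ps qs : X -> R) : Prop :=
  exists c' c'' : R,
    let L := lowset p q c' in
    let H := highset p q c'' in
    [/\ c' < 1 < c'',
        (mass p H - c'' * mass q H) / (1 + c'') = eta,
        (c' * mass q L - mass p L) / (1 + c') = eta,
        piecewise L H (fun i => c' * (p i + q i) / (1 + c'))
                      p
                      (fun i => c'' * (p i + q i) / (1 + c'')) ps &
        piecewise L H (fun i => (p i + q i) / (1 + c'))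
                      q
                      (fun i => (p i + q i) / (1 + c'')) qs].

Definition lfd_Hub (R : realType) (X : finType) (eta : R)
    (p q ps qs : X -> R) : Prop :=
  exists c' c'' : R,
    let L := lowset p q c' in
    let H := highset p q c'' in
    [/\ c' < 1 < c'',
        c' * mass q L - mass p L = eta / (1 - eta),
        mass p H / c'' - mass q H = eta / (1 - eta),
        piecewise L H (fun i => (1 - eta) * c' * q i)
                      (fun i => (1 - eta) * p i)
                      (fun i => (1 - eta) * p i) ps &
        piecewise L H (fun i => (1 - eta) * q i)
                      (fun i => (1 - eta) * q i)
                      (fun i => (1 - eta) * p i / c'') qs].

Definition lfd_Sub_regular (R : realType) (X : finType) (eta : R)
    (p q ps qs : X -> R) : Prop :=
  exists c' c'' : R,
    let L := lowset p q c' in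
    let H := highset p q c'' in
    [/\ c' < 1 < c'',
        mass p H - c'' * mass q H = eta / (1 + eta),
        mass q L - mass p L / c' = eta / (1 + eta),
        piecewise L H (fun i => (1 + eta) * p i)
                      (fun i => (1 + eta) * p i)
                      (fun i => c'' * (1 + eta) * q i) ps &
        piecewise L H (fun i => (1 + eta) / c' * p i)
                      (fun i => (1 + eta) * q i)
                      (fun i => (1 + eta) * q i) qs].

Definition lfd_Sub_infinite (R : realType) (X : finType) (eta : R)
    (p q ps qs : X -> R) : Prop :=
  exists c' : R,
    let L := lowset p q c' in
    let Hbar := infset p q in
    [/\ c' < 1,
        mass q L - mass p L / c' = eta / (1 + eta),
        piecewise L Hbar
          (fun i => (1 + eta) * p i)
          (fun i => (1 + eta) * p i)
          (fun i => (1 + eta) * p i * (1 - eta / ((1 + eta) * mass p Hbar))) ps &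
        piecewise L Hbar (fun i => (1 + eta) / c' * p i)
                         (fun i => (1 + eta) * q i)
                         (fun i => (1 + eta) * q i) qs].

Definition lfd_Sub (R : realType) (X : finType) (eta : R)
    (p q ps qs : X -> R) : Prop :=
  if eta / (1 + eta) < mass p (infset p q)
  then lfd_Sub_infinite eta p q ps qs
  else lfd_Sub_regular eta p q ps qs.

Definition lfd (R : realType) (X : finType) (A : model) (eta : R)
    (p q ps qs : X -> R) : Prop :=
  match A with
  | TV => lfd_TV eta p q ps qs
  | Hub => lfd_Hub eta p q ps qs
  | Sub => lfd_Sub eta p q ps qs
  end.

Definition lrt (R : realType) (X : finType) (ps qs : X -> R) (n : nat)
    (x : {ffun 'I_n -> X}) : nat :=
  if \prod_(i < n) qs (x i) <= \prod_(i < n) ps (x i) then 0%N else 1%N.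

Definition iidPr (R : realType) (X : finType) (P : X -> R) (n : nat)
    (E : pred {ffun 'I_n -> X}) : R :=
  \sum_(x : {ffun 'I_n -> X} | E x) \prod_(i < n) P (x i).

Definition worst_error (R : realType) (X : finType) (ps qs P Q : X -> R)
    (n : nat) : R :=
  Num.max (iidPr P [pred x : {ffun 'I_n -> X} | lrt ps qs x == 1%N])
          (iidPr Q [pred x : {ffun 'I_n -> X} | lrt ps qs x == 0%N]).

(* The points 1, 2, 3 are the ordinals 0, 1, 2. *)
Definition p3 (R : realType) (e : R) : 'I_3 -> R :=
  fun i => [:: 2^-1 - 10 * e; 2^-1 + 8 * e; 2 * e]`_i.

Definition q3 (R : realType) : 'I_3 -> R := fun i => [:: 2^-1; 2^-1; 0]`_i.

Definition tmax (R : realType) (A : model) : R :=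
  match A with TV => 3^-1 | Hub => 2^-1 | Sub => 1 end.

Definition eps2 (R : realType) (A : model) (e : R) : R :=
  match A with
  | TV => e
  | Hub => 2 * e / (1 + 2 * e)
  | Sub => 2 * e / (1 - 2 * e)
  end.

Definition eps1 (R : realType) (A : model) (t e : R) : R :=
  eps2 A e - e `^ (1 + t).

(* Main.v *)
(** Put u = e^t, so that e^(1+t) = e u. For small e the sets L and H are {1} and
    {3}, which determines the clips and hence the test. The log-likelihood
    ratios at 1, 2, 3 are ln c', ln (1 + 16 e), ln c'', with +oo at 3 for Sub.
    An adversary at level eps2 makes their mean have the wrong sign: under TV and
    Hub, Q2 moves as much mass as allowed to the point 3; under Sub, P2 deletes
    the point 3. The terms of order e and e u cancel in the mean for TV and Hub,
    leaving a positive term of order e u^3 (TV) or e u^2 (Hub) which beats the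
    O(e^2) remainder exactly because t < 1/3 or t < 1/2; for Sub the term
    - e u survives and t < 1 suffices. A Chernoff bound turns the sign of the
    mean into exponential convergence of the error to 1. *)
Require Import Defs.
From mathcomp Require Import all_boot all_order all_algebra.
From mathcomp Require Import all_classical all_reals all_analysis.
From mathcomp Require Import ring lra.
Import Order.TTheory GRing.Theory Num.Theory.
Import numFieldNormedType.Exports.
Local Open Scope classical_set_scope.
Local Open Scope ring_scope.

Set Implicit Arguments.
Unset Strict Implicit.
Unset Printing Implicit Defensive.

(** * Exponential moments and a Chernoff bound for product measures *)

Lemma expRN_le_quadratic (R : realType) (y : R) :
  `|y| <= 2^-1 -> expR (- y) <= 1 - y + 2 * y ^+ 2.
Proof.
rewrite ler_norml => /andP[ylo yhi].
rewrite expRN -ler_pV2 ?invrK ?inE ?unitfE ?invr_gt0 ?expR_gt0 ?invr_eq0 //;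
  last by rewrite gt_eqF ?expR_gt0.
  (* Invert exp y >= 1 + y: here (1 + y)(1 - y + 2 y^2) = 1 + y^2 (1 + 2 y), which is at least 1 as
     soon as y >= -1/2. *)
  by apply: (le_trans _ (expR_ge1Dx y)); rewrite -[_^-1]mul1r ler_pdivrMr; nra.
by rewrite andbC; apply/andP; split; [nra | rewrite gt_eqF; nra].
Qed.

(** With |l| <= B the quadratic bound gives a moment of at most 1 - s mu + 2 (s B)^2, and for small
    s the linear term wins. *)
Lemma exp_moment_lt1 (R : realType) (X : finType) (P l : X -> R) :
    simplex P -> 0 < \sum_x P x * l x ->
  exists2 s, 0 <= s & \sum_x P x * expR (- (s * l x)) < 1.
Proof.
move=> [P0 P1] mu_gt0; set mu := \sum_x _ in mu_gt0.
pose B := 1 + \sum_x `|l x|.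
have lB x : `|l x| <= B.
  rewrite /B (bigD1 x) //= addrCA lerDl addr_ge0 //; exact: sumr_ge0.
have B1 : 1 <= B by rewrite lerDl sumr_ge0.
have muB : mu <= B.
  rewrite -[B]mul1r -P1 mulr_suml; apply: ler_sum => x _.
  by apply: ler_wpM2l => //; apply: le_trans (lB x); exact: ler_norm.
(* The minimiser of - s mu + 2 (s B)^2. Since mu <= B and B >= 1, it keeps s B <= 1/4, inside the
   range of the quadratic bound. *)
pose s := mu / (4 * B ^+ 2).
have s_gt0 : 0 < s by rewrite divr_gt0 //; nra.
have sB : s * (4 * B ^+ 2) = mu by rewrite /s divfK // gt_eqF //; nra.
exists s; first exact: ltW.
apply: (@le_lt_trans _ _ (\sum_x P x * (1 - s * l x + 2 * (s * B) ^+ 2))).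
  apply: ler_sum => x _; apply: ler_wpM2l => //.
  have sl : `|s * l x| <= s * B by rewrite normrM gtr0_norm // ler_pM2l.
  apply: le_trans (expRN_le_quadratic _) _; first by nra.
  by rewrite lerD2l ler_pM2l //; move: sl; rewrite ler_norml => /andP[? ?]; nra.
have -> : \sum_x P x * (1 - s * l x + 2 * (s * B) ^+ 2) =
    1 - s * mu + 2 * (s * B) ^+ 2.
  transitivity (\sum_x (P x * (1 + 2 * (s * B) ^+ 2) - s * (P x * l x))).
    by apply: eq_bigr => x _; ring.
  by rewrite sumrB -mulr_suml P1 -mulr_sumr -/mu; ring.
nra.
Qed.

Lemma iidPr_ge0 (R : realType) (X : finType) (P : X -> R) n
    (E : pred {ffun 'I_n -> X}) : simplex P -> 0 <= iidPr P E.
Proof. by move=> [P0 _]; apply: sumr_ge0 => x _; exact: prodr_ge0. Qed.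

Lemma iidPr_compl (R : realType) (X : finType) (P : X -> R) n
    (E : pred {ffun 'I_n -> X}) :
  simplex P -> iidPr P E = 1 - iidPr P (predC E).
Proof.
move=> [_ P1]; apply/eqP; rewrite eq_sym subr_eq eq_sym; apply/eqP.
have <- : \sum_(x : {ffun 'I_n -> X}) \prod_(i < n) P (x i) = 1.
  by rewrite -(bigA_distr_bigA (fun _ => P)) big1.
by rewrite (bigID E).
Qed.

Lemma iidPr_le1 (R : realType) (X : finType) (P : X -> R) n
    (E : pred {ffun 'I_n -> X}) : simplex P -> iidPr P E <= 1.
Proof. by move=> sP; rewrite iidPr_compl // gerBl iidPr_ge0. Qed.

(* Chernoff: on the event, the product of [expR (- s * ln (f / g))] is >= 1. *)
Lemma iidPr_prod_le_exponential (R : realType) (X : finType) (P f g : X -> R) :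
    simplex P -> (forall x, P x != 0 -> 0 < f x /\ 0 < g x) ->
    0 < \sum_x P x * ln (f x / g x) ->
  exists2 r, 0 <= r < 1 & forall n,
    iidPr P [pred x : {ffun 'I_n -> X} |
              \prod_(i < n) f (x i) <= \prod_(i < n) g (x i)] <= r ^+ n.
Proof.
move=> sP fg_gt0 /(exp_moment_lt1 sP)[s s_ge0 r_lt1].
have [P0 _] := sP.
set r := \sum_x _ in r_lt1.
exists r => [|n].
  by rewrite r_lt1 andbT sumr_ge0 // => x _; rewrite mulr_ge0 ?expR_ge0.
(* The power r^n expands into a sum over all n-tuples; those outside the event contribute
   nonnegative terms and are dropped. *)
rewrite -[n in r ^+ n]card_ord -prodr_const /r bigA_distr_bigA /=.
rewrite /iidPr [leRHS](bigID [pred x : {ffun 'I_n -> X} |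
   \prod_(i < n) f (x i) <= \prod_(i < n) g (x i)]) /=.
rewrite -[leLHS]addr0 lerD //; last first.
  by apply: sumr_ge0 => x _; apply: prodr_ge0 => i _; rewrite mulr_ge0 ?expR_ge0.
apply: ler_sum => x fg; rewrite big_split /=.
(* Positivity of f and g is known only on the support of P, so tuples of probability 0 are treated
   apart. *)
have [->|Px0] := eqVneq (\prod_(i < n) P (x i)) 0; first by rewrite mul0r.
have fg0 i : 0 < f (x i) /\ 0 < g (x i).
  by apply: fg_gt0; move/prodf_neq0: Px0 => /(_ i); apply.
rewrite ler_peMr ?prodr_ge0 // -expR_sum sumrN -mulr_sumr.
rewrite -[leLHS]expR0 ler_expR oppr_ge0 mulr_ge0_le0 //.
rewrite -ler_expR expR0 expR_sum.
under eq_bigr => i _ do rewrite lnK ?posrE ?divr_gt0 ?(fg0 i).1 ?(fg0 i).2 //.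
rewrite prodf_div ler_pdivrMr ?mul1r //.
by apply: prodr_gt0 => i _; exact: (fg0 i).2.
Qed.

(** * From a drift of the wrong sign to worst error tending to 1 *)

Lemma limn_einf_eq1 (R : realType) (u : nat -> R) (r : R) :
    0 <= r < 1 -> (forall n, 1 - r ^+ n <= u n) -> (forall n, u n <= 1) ->
  limn_einf (fun n => (u n)%:E) = 1%E.
Proof.
move=> /andP[r0 r1] lo hi; apply: (cvg_limn_einf_sup _).1.
apply: cvg_EFin; first by near=> n.
apply: (@squeeze_cvgr _ _ _ _ (fun n => 1 - r ^+ n) (fun=> 1)).
- by near=> n; rewrite lo hi.
- rewrite -[X in _ --> X](subr0 (1 : R)); apply: cvgB; first exact: cvg_cst.
  by apply: cvg_expr; rewrite ger0_norm.
- exact: cvg_cst.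
Unshelve. all: by end_near. Qed.

Section WorstError.
Variables (R : realType) (X : finType) (ps qs P Q : X -> R).
Hypotheses (sP : simplex P) (sQ : simplex Q).

(** Ties are decided for p, so under P the test is right exactly on the event that the [qs] product
    is at most the [ps] product, which the Chernoff bound makes exponentially rare. *)
Lemma worst_error_to1_under_P :
    (forall x, P x != 0 -> 0 < qs x /\ 0 < ps x) ->
    0 < \sum_x P x * ln (qs x / ps x) ->
  limn_einf (fun n => (worst_error ps qs P Q n)%:E) = 1%E.
Proof.
move=> pos mu.
have [r r01 rP] := iidPr_prod_le_exponential sP pos mu.
apply: limn_einf_eq1 r01 _ _ => n; last by rewrite ge_max !iidPr_le1.
rewrite le_max; apply/orP; left; rewrite iidPr_compl // lerB //.
apply: le_trans (rP n); rewrite le_eqVlt; apply/orP; left; apply/eqP.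
by apply: eq_bigl => x; rewrite /= /lrt; case: ifP.
Qed.

Lemma worst_error_to1_under_Q :
    (forall x, Q x != 0 -> 0 < ps x /\ 0 < qs x) ->
    0 < \sum_x Q x * ln (ps x / qs x) ->
  limn_einf (fun n => (worst_error ps qs P Q n)%:E) = 1%E.
Proof.
move=> pos mu; have [Q0 _] := sQ.
have [r r01 rQ] := iidPr_prod_le_exponential sQ pos mu.
apply: limn_einf_eq1 r01 _ _ => n; last by rewrite ge_max !iidPr_le1.
rewrite le_max; apply/orP; right; rewrite iidPr_compl // lerB //.
apply: le_trans (rQ n); rewrite /iidPr.
(* Under Q the test is right only on a strict inequality; the event of the Chernoff bound also
   contains the ties, whose probability is split off here. *)
rewrite [leRHS](bigID [pred x | lrt ps qs x == 0%N]) /=.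
rewrite -[leLHS]add0r lerD ?sumr_ge0 // => [x _|]; first exact: prodr_ge0.
rewrite le_eqVlt; apply/orP; left; apply/eqP; apply: eq_bigl => x /=.
rewrite /lrt; case: ifP => [_|/negbT]; first by rewrite andbF.
by rewrite -ltNge => /ltW ->.
Qed.

End WorstError.

(** * Elementary bounds for the logarithm *)

(** These are the first two terms of the series of 2 artanh u. The cubic term decides the sign of
    the drift under TV. The difference of the two sides vanishes at 0 and has derivative 2 x^4 / (1
    - x^2) >= 0. *)
Lemma ln_artanh_ge (R : realType) (u : R) : 0 <= u < 1 ->
  2 * u + 2 / 3 * u ^+ 3 <= ln ((1 + u) / (1 - u)).
Proof.
move=> /andP[u_ge0 u_lt1].
pose F (x : R) := ln (1 + x) - ln (1 - x) - (2 * x + 2 / 3 * x ^+ 3).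
have dF x : 0 <= x <= u ->
    is_derive x 1 F ((1 + x)^-1 + (1 - x)^-1 - (2 + 2 * x ^+ 2)).
  move=> /andP[x_ge0 x_leu].
  have sc (a b : R) : a *: b = a * b by [].
  have x1 : 0 < 1 + x by lra.
  have x2 : 0 < 1 - x by lra.
  have g1 : is_derive x 1 (fun x : R => 1 + x) 1.
    by apply: is_derive_eq; rewrite ?sc; lra.
  have g2 : is_derive x 1 (fun x : R => 1 - x) (-1).
    by apply: is_derive_eq; rewrite ?sc; lra.
  have d1 := @is_derive1_comp R (@ln R) (fun x => 1 + x) x _ _
    (is_derive1_ln x1) g1.
  have d2 := @is_derive1_comp R (@ln R) (fun x => 1 - x) x _ _
    (is_derive1_ln x2) g2.
  have d3 : is_derive x 1 (fun x : R => 2 * x + 2 / 3 * x ^+ 3)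
      (2 + 2 * x ^+ 2).
    by apply: is_derive_eq; rewrite !sc; field.
  apply: (is_derive_eq (is_deriveB (is_deriveB d1 d2) d3)); ring.
have [c] : exists2 c, c \in `[0, u] & F u - F 0 =
    ((1 + c)^-1 + (1 - c)^-1 - (2 + 2 * c ^+ 2)) * (u - 0).
  apply: (@MVT_segment R F (fun c => (1 + c)^-1 + (1 - c)^-1 - (2 + 2 * c ^+ 2))).
  - exact: u_ge0.
  - move=> x; rewrite in_itv /= => /andP[x0 xu]; apply: dF.
    by rewrite !ltW.
  - apply: derivable_within_continuous => x; rewrite in_itv /= => /dF h.
    exact: ex_derive.
rewrite in_itv /= => /andP[c_ge0 c_leu] FE.
have Fu : 0 <= F u - F 0.
  rewrite FE subr0 mulr_ge0 //.
  have -> : (1 + c)^-1 + (1 - c)^-1 - (2 + 2 * c ^+ 2) =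
      2 * c ^+ 4 / ((1 + c) * (1 - c)).
    by field; apply/andP; split; rewrite gt_eqF //; lra.
  by rewrite divr_ge0 ?mulr_ge0 ?exprn_ge0 //; lra.
rewrite ln_div ?posrE; [|lra..].
by move: Fu; rewrite /F addr0 subr0 ln1 expr0n /=; lra.
Qed.

(** The Taylor coefficient of v^2 is 1/2; the smaller 1/8 is easier to prove and still leaves the
    positive quadratic term that the Hub drift needs. *)
Lemma ln_inv1B_ge (R : realType) (v : R) : 0 <= v < 1 ->
  v + v ^+ 2 / 8 <= ln (1 - v)^-1.
Proof.
move=> /andP[v_ge0 v_lt1].
rewrite lnV ?posrE ?subr_gt0 // lerNr -ler_expR lnK ?posrE ?subr_gt0 //.
set w := v + v ^+ 2 / 8.
(* The bound exp(-w) >= 1 - w is too weak. Halving the exponent and squaring gives (1 - w/2)^2 = 1 -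
   w + w^2/4, and w^2/4 >= v^2/8 because w >= v. *)
have -> : - w = - (w / 2) + - (w / 2) by field.
rewrite expRD; have := expR_ge1Dx (- (w / 2)); have : w / 2 <= 1 by rewrite /w; nra.
set E := expR _ => w1 wE; apply: (@le_trans _ _ ((1 - w / 2) ^+ 2)).
  by rewrite /w; nra.
nra.
Qed.

Lemma ln_le_subr1 (R : realType) (x : R) : 0 < x -> ln x <= x - 1.
Proof.
by move=> x_gt0; rewrite -{1}[x](subrKC 1); apply: le_ln1Dx; lra.
Qed.

Lemma ln_ge_1BV (R : realType) (x : R) : 0 < x -> 1 - x^-1 <= ln x.
Proof.
move=> x_gt0; have := @ln_le_subr1 R x^-1.
by rewrite invr_gt0 lnV ?posrE // => /(_ x_gt0); lra.
Qed.

Lemma ln1B_ge (R : realType) (y : R) : 0 <= y <= 2^-1 ->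
  - (y + 2 * y ^+ 2) <= ln (1 - y).
Proof.
move=> /andP[y0 y1]; apply: le_trans (ln_ge_1BV _); last lra.
suff: (1 - y)^-1 <= 1 + y + 2 * y ^+ 2 by lra.
by rewrite -[_^-1]mul1r ler_pdivrMr; nra.
Qed.

Lemma ln1D_ge (R : realType) (y : R) : 0 <= y -> y - y ^+ 2 <= ln (1 + y).
Proof.
move=> y0; apply: le_trans (ln_ge_1BV _); last lra.
suff: (1 + y)^-1 <= 1 - y + y ^+ 2 by lra.
by rewrite -[_^-1]mul1r ler_pdivrMr; nra.
Qed.

(** * Orders of magnitude as e tends to 0 *)

Lemma near_powR_small (R : realType) (t d : R) (k : nat) :
    0 < t -> k%:R * t < 1 -> 0 < d ->
  \forall e \near (0 : R)^'+,
    [/\ 0 < e, 0 < e `^ t, e `^ t < d & e < d * (e `^ t) ^+ k].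
Proof.
move=> t0 kt d0.
have small s : 0 < s -> \forall e \near (0 : R)^'+, e `^ s < d.
  by move=> s0; move/cvgr_lt: (powR_cvg0 s0); apply.
near=> e.
have e0 : 0 < e by near: e; exact: nbhs_right_gt.
split => //; first by rewrite powR_gt0.
  by near: e; exact: small.
rewrite -powR_mulrn ?powR_ge0 // -powRrM.
(* The factor e^(1 - k t) tends to 0 because k t < 1; this is where the upper bound on t enters. *)
have {1}-> : e = e `^ (1 - t * k%:R) * e `^ (t * k%:R).
  by rewrite -powRD ?subrK ?powRr1 ?(ltW e0) // (gt_eqF e0) implybT.
rewrite ltr_pM2r ?powR_gt0 //.
by near: e; apply: small; lra.
Unshelve. all: by end_near. Qed.

Lemma powR1D (R : realType) (t e : R) : 0 < e -> e `^ (1 + t) = e * e `^ t.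
Proof.
by move=> e0; rewrite powRD ?powRr1 ?(ltW e0) // (gt_eqF e0) implybT.
Qed.

(** The difference is - e e^t, where e^t tends to 0, and [eps2] is at least e near 0 in all three
    models. *)
Lemma eps1_eqo (R : realType) (A : model) (t : R) : 0 < t ->
  eps1 A t = @eps2 R A +o_ ((0 : R)^'+) (@eps2 R A).
Proof.
move=> t0; apply/eqaddoP => _/posnumP[d]; near=> e.
have e0 : 0 < e by near: e; exact: nbhs_right_gt.
have e4 : e < 4^-1 by near: e; apply: nbhs_right_lt.
have le_eps2 : e <= eps2 A e.
  by case: A => //=; rewrite ler_pdivlMr; nra.
have -> : (eps1 A t - eps2 A) e = - (e * e `^ t).
  transitivity (eps1 A t e - eps2 A e); first by [].
  by rewrite /eps1 powR1D //; ring.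
rewrite normrN normrM gtr0_norm // ger0_norm ?powR_ge0 //.
rewrite ger0_norm ?(le_trans _ le_eps2) ?(ltW e0) // mulrC.
apply: ler_pM; rewrite ?powR_ge0 ?(ltW e0) //; near: e.
by move/cvgr_le: (powR_cvg0 t0); apply.
Unshelve. all: by end_near. Qed.

(** * The three-point space: likelihood ratios, clipping sets and their masses *)

Local Notation i0 := (@Ordinal 3 0 isT).
Local Notation i1 := (@Ordinal 3 1 isT).
Local Notation i2 := (@Ordinal 3 2 isT).

Lemma ord3_ind (P : 'I_3 -> Prop) : P i0 -> P i1 -> P i2 -> forall i, P i.
Proof.
by move=> P0 P1 P2 [[|[|[|//]]] lti]; rewrite (bool_irrelevance lti isT).
Qed.

Lemma sum_ord3 (R : realType) (f : 'I_3 -> R) :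
  \sum_i f i = f i0 + f i1 + f i2.
Proof.
rewrite !big_ord_recl big_ord0 addr0 addrA.
by congr (f _ + f _ + f _); apply: val_inj.
Qed.

Lemma simplex3 (R : realType) (a b c : R) :
    0 <= a -> 0 <= b -> 0 <= c -> a + b + c = 1 ->
  simplex (fun i : 'I_3 => [:: a; b; c]`_i).
Proof. by move=> a0 b0 c0 abc; split; [exact: ord3_ind | rewrite sum_ord3]. Qed.

Lemma simplex_p3 (R : realType) (e : R) : 0 < e < 20^-1 -> simplex (p3 e).
Proof. by move=> /andP[? ?]; apply: simplex3; lra. Qed.

Lemma simplex_q3 (R : realType) : simplex (@q3 R).
Proof. by apply: simplex3; lra. Qed.

Section PointSets.
Context {R : realType} (e : R).
Hypothesis e_small : 0 < e < 20^-1.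

Lemma ratio_p3 (i : 'I_3) : Defs.ratio (p3 e) (@q3 R) i =
  nth +oo%E [:: (1 - 20 * e)%:E; (1 + 16 * e)%:E] i.
Proof.
have /andP[e0 e1] := e_small.
elim/ord3_ind: i; rewrite /Defs.ratio /p3 /q3 /=.
- by rewrite (gt_eqF (_ : 0 < 2^-1)) ?andbF; [congr EFin; field | lra].
- by rewrite (gt_eqF (_ : 0 < 2^-1)) ?andbF; [congr EFin; field | lra].
- by rewrite !eqxx mulr_gt0.
Qed.

Lemma lowset_p3 (c : R) (i : 'I_3) : c < 1 ->
  (i \in lowset (p3 e) (@q3 R) c) = (i == i0) && (1 - 20 * e < c).
Proof.
have /andP[e0 e1] := e_small.
move=> c1; rewrite inE ratio_p3; elim/ord3_ind: i => //=.
by rewrite lte_fin; apply/negbTE; rewrite -leNgt; lra.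
Qed.

Lemma highset_p3 (c : R) (i : 'I_3) : 1 < c ->
  (i \in highset (p3 e) (@q3 R) c) = (i == i1) && (c < 1 + 16 * e) || (i == i2).
Proof.
have /andP[e0 e1] := e_small.
move=> c1; rewrite inE ratio_p3; elim/ord3_ind: i => //=.
- by rewrite lte_fin; apply/negbTE; rewrite -leNgt; lra.
- by rewrite orbF.
- by rewrite ltry.
Qed.

Lemma infset_p3 (i : 'I_3) : (i \in infset (p3 e) (@q3 R)) = (i == i2).
Proof.
have /andP[e0 e1] := e_small.
rewrite inE; elim/ord3_ind: i; rewrite /p3 /q3 /=.
- by rewrite (gt_eqF (_ : 0 < 2^-1)) ?andbF //; lra.
- by rewrite (gt_eqF (_ : 0 < 2^-1)) ?andbF //; lra.
- by rewrite !eqxx mulr_gt0.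
Qed.

Lemma mass_lowset_p3 (f : 'I_3 -> R) (c : R) : c < 1 ->
  mass f (lowset (p3 e) (@q3 R) c) = if 1 - 20 * e < c then f i0 else 0.
Proof.
move=> c1; rewrite /mass big_mkcond sum_ord3 !lowset_p3 //=.
by rewrite !addr0.
Qed.

Lemma mass_highset_p3 (f : 'I_3 -> R) (c : R) : 1 < c ->
  mass f (highset (p3 e) (@q3 R) c) =
  (if c < 1 + 16 * e then f i1 else 0) + f i2.
Proof.
move=> c1; rewrite /mass big_mkcond sum_ord3 !highset_p3 //=.
by rewrite orbF add0r.
Qed.

Lemma mass_infset_p3 (f : 'I_3 -> R) : mass f (infset (p3 e) (@q3 R)) = f i2.
Proof. by rewrite /mass big_mkcond sum_ord3 !infset_p3 //= !add0r. Qed.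

(** Clips in these ranges separate the ratios 1 - 20 e, 1 + 16 e and +oo so that L = {1} and H =
    {3}, leaving one formula per point. *)
Lemma piecewise_low_high_p3 (c c' : R) (l m h f : 'I_3 -> R) :
    1 - 20 * e < c < 1 -> 1 < c' -> 1 + 16 * e <= c' ->
  piecewise (lowset (p3 e) (@q3 R) c) (highset (p3 e) (@q3 R) c') l m h f <->
  forall i, f i = [:: l i0; m i1; h i2]`_i.
Proof.
move=> /andP[c0 c1] c'1 c'e; split=> H.
  apply: ord3_ind; rewrite H !lowset_p3 // !highset_p3 //= ?c0 //.
  by rewrite ltNge c'e.
apply: ord3_ind; rewrite H !lowset_p3 // !highset_p3 //= ?c0 //.
by rewrite ltNge c'e.
Qed.

Lemma piecewise_low_inf_p3 (c : R) (l m h f : 'I_3 -> R) :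
    1 - 20 * e < c < 1 ->
  piecewise (lowset (p3 e) (@q3 R) c) (infset (p3 e) (@q3 R)) l m h f <->
  forall i, f i = [:: l i0; m i1; h i2]`_i.
Proof.
move=> /andP[c0 c1]; split=> H;
  by apply: ord3_ind; rewrite H !lowset_p3 // !infset_p3 //= ?c0.
Qed.

End PointSets.

(** * Least favourable pairs in closed form *)

(** Here u stands for e^t, and k is 3, 2, 1 for TV, Hub, Sub. The factors 100 are slack that lets
    the later estimates close by linear arithmetic in monomials such as e u and e^2. *)
Definition small (R : realType) (k : nat) (e u : R) : Prop :=
  [/\ 0 < e, 0 < u, u * 100 < 1 & e * 100 * 100 < u ^+ k].

Lemma small_lt (R : realType) (k : nat) (e u : R) :
  small k.+1 e u -> e * 100 * 100 < u.
Proof.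
move=> [e0 u0 u1 eu].
have : u ^+ k.+1 <= u by rewrite -[leRHS]expr1 ler_wiXn2l //; lra.
lra.
Qed.

Lemma small_lt20 (R : realType) (k : nat) (e u : R) :
  small k.+1 e u -> 0 < e < 20^-1.
Proof.
move=> s; have := small_lt s; case: s => e0 u0 u1 _ eu; rewrite e0 /=; lra.
Qed.

(* The solutions of the clip equations with [u = e `^ t]. *)
Definition tv_low (R : realType) (e u : R) : R :=
  (1 - 18 * e - 2 * (e * u)) / (1 - 2 * e + 2 * (e * u)).

Definition tv_high (R : realType) (u : R) : R := (1 + u) / (1 - u).

(** Left to right, the clip equations force the clips, so a single adversary handles every
    admissible pair; right to left, a pair exists. *)
Lemma lfd_TV_p3 (R : realType) (e u : R) (ps qs : 'I_3 -> R) : small 3 e u ->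
  let c1 := tv_low e u in let c2 := tv_high u in
  lfd_TV (e - e * u) (p3 e) (@q3 R) ps qs <->
  (forall i, ps i = [:: c1 * (1 - 10 * e) / (1 + c1); 2^-1 + 8 * e;
                       c2 * (2 * e) / (1 + c2)]`_i) /\
  (forall i, qs i = [:: (1 - 10 * e) / (1 + c1); 2^-1;
                       2 * e / (1 + c2)]`_i).
Proof.
move=> s c1 c2; have e_small := small_lt20 s; have e_lt_u := small_lt s.
case: s => e0 u0 u1 _.
have c1def : c1 = (1 - 18 * e - 2 * (e * u)) / (1 - 2 * e + 2 * (e * u)) by [].
have c2def : c2 = (1 + u) / (1 - u) by [].
move: c1 c2 c1def c2def => c1 c2 c1def c2def.
have eu0 : 0 < e * u by rewrite mulr_gt0.
have eu_e : e * u * 100 < e by rewrite -mulrA gtr_pMr //.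
have pE : p3 e i0 + @q3 R i0 = 1 - 10 * e by rewrite /p3 /q3 /=; lra.
have pE2 : p3 e i2 + @q3 R i2 = 2 * e by rewrite /p3 /q3 /=; lra.
have d1 : 0 < 1 - 2 * e + 2 * (e * u) by lra.
have d2 : 0 < 1 - u by lra.
have c1E : c1 * (1 - 2 * e + 2 * (e * u)) = 1 - 18 * e - 2 * (e * u).
  by rewrite c1def divfK // gt_eqF.
have eeu0 : 0 < e * (e * u) by rewrite mulr_gt0.
have ee : e * e * 100 < e by rewrite -mulrA gtr_pMr //; lra.
have c2E : c2 * (1 - u) = 1 + u by rewrite c2def divfK // gt_eqF.
have c1b : 1 - 20 * e < c1 < 1.
  by apply/andP; split; rewrite c1def ?ltr_pdivlMr ?ltr_pdivrMr //; lra.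
have c2b : 1 < c2 by rewrite c2def ltr_pdivlMr //; lra.
have c2e : 1 + 16 * e <= c2 by rewrite c2def ler_pdivlMr //; lra.
split.
- move=> [c' [c'' [/andP[c'1 c''1]]]].
  rewrite !(mass_lowset_p3 e_small) // !(mass_highset_p3 e_small) //.
  (* Such a clip would put the point 2 into H. Then p(H) - c'' q(H) exceeds 2 e, which is more than
     eta (1 + c'') because u dominates e. *)
  have [lt|le] := ltP c'' (1 + 16 * e).
    move=> /(canRL (divfK _)) => /(_ (lt0r_neq0 _)).
    rewrite /p3 /q3 /=; have : 0 < 1 + c'' by lra.
    by move=> h /(_ h); nra.
  (* Otherwise L is empty and its clip equation would give level 0, whereas eta > 0. *)
  have [lt|le'] := ltP (1 - 20 * e) c'; last first.
    by move=> _; rewrite mulr0 subr0 mul0r; nra.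
  rewrite (piecewise_low_high_p3 e_small) // ?lt // => eqH eqL.
  rewrite (piecewise_low_high_p3 e_small) // ?lt //.
  have -> : c' = c1.
    move/(canRL (divfK _)): eqL => /(_ (lt0r_neq0 _)).
    have h : 0 < 1 + c' by lra.
    move=> /(_ h); rewrite /p3 /q3 /= => eqL.
    by apply: (mulIf (lt0r_neq0 d1)); rewrite c1E; lra.
  have -> : c'' = c2.
    move/(canRL (divfK _)): eqH => /(_ (lt0r_neq0 _)).
    have h : 0 < 1 + c'' by lra.
    move=> /(_ h); rewrite /p3 /q3 /= => eqH.
    apply: (mulIf (lt0r_neq0 d2)); rewrite c2E.
    by apply: (mulfI (lt0r_neq0 e0)); lra.
  by rewrite pE pE2.
- move=> [psE qsE]; exists c1, c2; cbv zeta.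
  have /andP[c1lo c1hi] := c1b.
  have c2n : (c2 < 1 + 16 * e) = false by rewrite ltNge c2e.
  rewrite !(mass_lowset_p3 e_small) // !(mass_highset_p3 e_small) //.
  rewrite c1lo c2n /= c1hi c2b; split=> //.
  + apply: (canLR (mulfK _)); first by rewrite gt_eqF //; lra.
    by rewrite /p3 /q3 /=; nra.
  + apply: (canLR (mulfK _)); first by rewrite gt_eqF //; lra.
    by rewrite /p3 /q3 /=; lra.
  + by rewrite (piecewise_low_high_p3 e_small) // pE pE2.
  + by rewrite (piecewise_low_high_p3 e_small) // pE pE2.
Qed.

(* [eta / (1 - eta)] for [eta = eps1 Hub t e]. *)
Definition hub_kappa (R : realType) (e u : R) : R :=
  (2 * e - (1 + 2 * e) * (e * u)) / (1 + (1 + 2 * e) * (e * u)).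

(** With L = {1} and H = {3} the clip equations are linear in c' and in 1/c'', with right-hand side
    [hub_kappa]. *)
Lemma lfd_Hub_p3 (R : realType) (e u : R) (ps qs : 'I_3 -> R) : small 2 e u ->
  let eta := 2 * e / (1 + 2 * e) - e * u in
  let c1 := 1 - 20 * e + 2 * hub_kappa e u in
  let c2 := 2 * e / hub_kappa e u in
  lfd_Hub eta (p3 e) (@q3 R) ps qs <->
  (forall i, ps i = [:: (1 - eta) * c1 * 2^-1; (1 - eta) * (2^-1 + 8 * e);
                       (1 - eta) * (2 * e)]`_i) /\
  (forall i, qs i = [:: (1 - eta) * 2^-1; (1 - eta) * 2^-1;
                       (1 - eta) * (2 * e) / c2]`_i).
Proof.
move=> s; have e_small := small_lt20 s; have e_lt_u := small_lt s.
case: s => e0 u0 u1 _ eta c1 c2.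
have eu0 : 0 < e * u by rewrite mulr_gt0.
have eu_e : e * u * 100 < e by rewrite -mulrA gtr_pMr.
have ee : e * e * 100 < e by rewrite -mulrA gtr_pMr //; lra.
have eeu0 : 0 < e * (e * u) by rewrite mulr_gt0.
have eeu : e * (e * u) < e * u by rewrite gtr_pMl //; lra.
have eeeu : e * e * 100 * 100 < e * u by rewrite -!mulrA ltr_pM2l // mulrA.
have den : 0 < 1 + (1 + 2 * e) * (e * u) by lra.
have etaE : eta / (1 - eta) = hub_kappa e u.
  rewrite /eta /hub_kappa; field.
  by apply/andP; split; rewrite gt_eqF //; lra.
have kE : hub_kappa e u * (1 + (1 + 2 * e) * (e * u)) =
    2 * e - (1 + 2 * e) * (e * u) by rewrite /hub_kappa divfK // gt_eqF.
have d_lo : e * u < (1 + 2 * e) * (e * u) by lra.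
have d_hi : (1 + 2 * e) * (e * u) * 10 < e by lra.
have ed : e * ((1 + 2 * e) * (e * u)) < (1 + 2 * e) * (e * u).
  by rewrite gtr_pMl //; lra.
have ed0 : 0 < e * ((1 + 2 * e) * (e * u)) by rewrite mulr_gt0 //; lra.
(* At level [eps2] the quotient eta / (1 - eta) is exactly 2 e. The decrement e u lowers it enough
   for [c2] to exceed 1 + 16 e, the ratio at 2; the same inequality rules out clips below that
   ratio. *)
have [k_lo k_hi] : e < hub_kappa e u /\ hub_kappa e u * (1 + 16 * e) < 2 * e.
  rewrite /hub_kappa mulrAC ltr_pdivlMr // ltr_pdivrMr //.
  by move: (_ * (e * u)) d_lo d_hi ed ed0 => d *; split; lra.
rewrite /lfd_Hub etaE.
have c1def : c1 = 1 - 20 * e + 2 * hub_kappa e u by [].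
have c2def : c2 = 2 * e / hub_kappa e u by [].
move: (hub_kappa e u) eta c1 c2 kE k_lo k_hi {etaE} c1def c2def.
move=> k eta c1 c2 kE k_lo k_hi c1def c2def.
have k0 : 0 < k by lra.
have ek0 : 0 < e * k by rewrite mulr_gt0.
have c2E : c2 * k = 2 * e by rewrite c2def divfK // gt_eqF.
have c1b : 1 - 20 * e < c1 < 1 by rewrite c1def; apply/andP; split; lra.
have c2e : 1 + 16 * e <= c2 by rewrite c2def ler_pdivlMr //; lra.
have c2b : 1 < c2 by lra.
split.
- move=> [c' [c'' [/andP[c'1 c''1]]]].
  rewrite !(mass_lowset_p3 e_small) // !(mass_highset_p3 e_small) //.
  have c''0 : 0 < c'' by lra.
  have [lt|le] := ltP c'' (1 + 16 * e).
    move=> _ /(congr1 ( *%R^~ c'')).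
    rewrite mulrBl divfK ?gt_eqF // /p3 /q3 /=.
    have : k * c'' < k * (1 + 16 * e) by rewrite ltr_pM2l.
    by lra.
  have [lt|le'] := ltP (1 - 20 * e) c'; last by rewrite mulr0 subr0; lra.
  rewrite !(piecewise_low_high_p3 e_small) ?lt //.
  rewrite /p3 /q3 /= add0r add0r subr0 => eqL eqH.
  have -> : c' = c1 by lra.
  have -> : c'' = c2 by rewrite c2def -eqH invf_div mulrCA divff ?mulr1 // gt_eqF //; lra.
  by [].
- move=> [psE qsE]; exists c1, c2; cbv zeta.
  have /andP[c1lo c1hi] := c1b.
  have c2n : (c2 < 1 + 16 * e) = false by rewrite ltNge c2e.
  rewrite !(mass_lowset_p3 e_small) // !(mass_highset_p3 e_small) //.
  rewrite c1lo c2n /= c1hi c2b; split=> //.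
  + by rewrite /p3 /q3 /=; lra.
  + rewrite /p3 /q3 /= add0r addr0 subr0 c2def invf_div mulrCA divff ?mulr1 //.
    by rewrite gt_eqF //; lra.
  + exact/(piecewise_low_high_p3 e_small).
  + exact/(piecewise_low_high_p3 e_small).
Qed.

(* [eta / (1 + eta)] for [eta = eps1 Sub t e]. It is below [2 * e], the p-mass of
   the point 3, so the case without [c''] applies. *)
Definition sub_kappa (R : realType) (e u : R) : R :=
  (2 * e - (1 - 2 * e) * (e * u)) / (1 - (1 - 2 * e) * (e * u)).

Lemma lfd_Sub_p3 (R : realType) (e u : R) (ps qs : 'I_3 -> R) : small 1 e u ->
  let eta := 2 * e / (1 - 2 * e) - e * u in
  let k := sub_kappa e u in
  let c1 := (1 - 20 * e) / (1 - 2 * k) in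
  lfd_Sub eta (p3 e) (@q3 R) ps qs <->
  (forall i, ps i = [:: (1 + eta) * (2^-1 - 10 * e); (1 + eta) * (2^-1 + 8 * e);
     (1 + eta) * (2 * e) * (1 - eta / ((1 + eta) * (2 * e)))]`_i) /\
  (forall i, qs i = [:: (1 + eta) / c1 * (2^-1 - 10 * e); (1 + eta) * 2^-1;
                       (1 + eta) * 0]`_i).
Proof.
move=> s; have e_small := small_lt20 s; have e_lt_u := small_lt s.
case: s => e0 u0 u1 _ eta k c1.
have eu0 : 0 < e * u by rewrite mulr_gt0.
have eu_e : e * u * 100 < e by rewrite -mulrA gtr_pMr.
have ee : e * e * 100 < e by rewrite -mulrA gtr_pMr //; lra.
have eeu0 : 0 < e * (e * u) by rewrite mulr_gt0.
have eeu : e * (e * u) * 100 < e * u by rewrite mulrAC gtr_pMl //; lra.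
have den : 0 < 1 - (1 - 2 * e) * (e * u) by lra.
have etaE : eta / (1 + eta) = k.
  rewrite /eta /k /sub_kappa; field.
  by apply/andP; split; rewrite gt_eqF //; lra.
have k_lo : 0 < k by rewrite /k /sub_kappa divr_gt0 //; lra.
(* At level [eps2] the quotient eta / (1 + eta) is exactly 2 e; the decrement e u makes the
   inequality strict. *)
have k_hi : k < 2 * e.
  have ed : 0 < (1 - 2 * e) * ((1 - 2 * e) * (e * u)) by rewrite !mulr_gt0 //; lra.
  by rewrite /k /sub_kappa ltr_pdivrMr //; lra.
rewrite /lfd_Sub /lfd_Sub_infinite (mass_infset_p3 e_small) etaE.
rewrite {1}/p3 /= k_hi.
have c1def : c1 = (1 - 20 * e) / (1 - 2 * k) by [].
move: k eta c1 k_lo k_hi c1def {etaE} => k eta c1 k_lo k_hi c1def.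
have ek : 0 < e * k by rewrite mulr_gt0.
have d1 : 0 < 1 - 2 * k by lra.
have c1E : c1 * (1 - 2 * k) = 1 - 20 * e by rewrite c1def divfK // gt_eqF.
have c1b : 1 - 20 * e < c1 < 1.
  by apply/andP; split; rewrite c1def ?ltr_pdivlMr ?ltr_pdivrMr //; nra.
split.
- move=> [c' [c'1]].
  rewrite !(mass_lowset_p3 e_small) //.
  have [lt|le'] := ltP (1 - 20 * e) c'; last by rewrite mul0r subr0; lra.
  rewrite !(piecewise_low_inf_p3 e_small) ?lt // => eqL.
  have -> // : c' = c1.
  have c'0 : 0 < c' by lra.
  move/(congr1 ( *%R^~ c')): eqL.
  rewrite mulrBl divfK ?gt_eqF // /p3 /q3 /= => eqL.
  by apply: (mulIf (lt0r_neq0 d1)); rewrite c1E; lra.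
- move=> [psE qsE]; exists c1; cbv zeta.
  have /andP[c1lo c1hi] := c1b.
  have c10 : 0 < c1 by lra.
  rewrite !(mass_lowset_p3 e_small) // c1lo c1hi; split=> //.
  + apply: (mulIf (lt0r_neq0 c10)).
    by rewrite mulrBl divfK ?gt_eqF // /p3 /q3 /=; lra.
  + exact/(piecewise_low_inf_p3 e_small).
  + exact/(piecewise_low_inf_p3 e_small).
Qed.

(** * Signs of the mean log-likelihood ratios *)

(** The mean under (1/2 - e, 1/2, e). The three points contribute about - 8 e - 2 e u, 8 e and 2 e u
    + (2/3) e u^3; only the cubic term survives, and it beats the O(e^2) errors since e is far below
    u^3. *)
Lemma tv_drift (R : realType) (e u : R) : small 3 e u ->
  0 < (2^-1 - e) * ln (tv_low e u) + 2^-1 * ln (1 + 16 * e) +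
      e * ln (tv_high u).
Proof.
move=> s; have e_lt_u := small_lt s; case: s => e0 u0 u1 eu3.
have eu0 : 0 < e * u by rewrite mulr_gt0.
have eu_e : e * u * 100 < e by rewrite -mulrA gtr_pMr.
have ee : e * e * 100 < e by rewrite -mulrA gtr_pMr //; lra.
have ee0 : 0 < e * e by rewrite mulr_gt0.
have eeu : e * (e * u) < e * e by rewrite ltr_pM2l //; lra.
have eeu0 : 0 < e * (e * u) by rewrite mulr_gt0.
have eeu3 : e * e * 100 * 100 < e * u ^+ 3 by rewrite -!mulrA ltr_pM2l // mulrA.
have den : 0 < 1 - 2 * e + 2 * (e * u) by lra.
pose y := 1 - tv_low e u.
have y_den : y * (1 - 2 * e + 2 * (e * u)) = 16 * e + 4 * (e * u).
  by rewrite /y mulrBl mul1r /tv_low divfK ?gt_eqF //; lra.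
have y_gt0 : 0 < y by rewrite -(pmulr_lgt0 _ den) y_den; lra.
have y_le21 : y <= 21 * e.
  rewrite -(ler_pM2r den) y_den; lra.
have ye : y * e <= 21 * (e * e) by rewrite mulrA ler_pM2r.
have yeu0 : 0 < y * (e * u) by rewrite mulr_gt0.
have y_le : y <= 16 * e + 4 * (e * u) + 42 * (e * e) by lra.
have y2 : y ^+ 2 <= 441 * (e * e).
  by rewrite (_ : 441 * (e * e) = (21 * e) ^+ 2) ?ler_sqr ?nnegrE; [|lra|lra|ring].
have tvE : tv_low e u = 1 - y by rewrite /y; ring.
move: (tv_low e u) y tvE y_den y_gt0 y_le21 ye yeu0 y_le y2 => c1 y -> *.
have l1 : - (y + 2 * y ^+ 2) <= ln (1 - y) by apply: ln1B_ge; lra.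
have l1' : ln (1 - y) < 0 by apply: ln_lt0; lra.
(* The part - e ln c' of the first summand is positive and can be discarded. *)
have el1 : e * ln (1 - y) < 0 by rewrite pmulr_rlt0.
have l2 := @ln1D_ge R (16 * e).
have l3 : 2 * u + 2 / 3 * u ^+ 3 <= ln (tv_high u) by apply: ln_artanh_ge; lra.
have l3' : e * (2 * u + 2 / 3 * u ^+ 3) <= e * ln (tv_high u) by rewrite ler_pM2l.
have {l2} l2 : 16 * e - (16 * e) ^+ 2 <= ln (1 + 16 * e) by apply: l2; lra.
lra.
Qed.

(** The contributions are about - 8 e - e u, 8 e and at least e u + e u^2 / 16; the quadratic term
    beats the O(e^2) errors since e is far below u^2. *)
Lemma hub_drift (R : realType) (e u : R) : small 2 e u ->
  0 < 2^-1 * ln (1 - 20 * e + 2 * hub_kappa e u) + 2^-1 * ln (1 + 16 * e) +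
      2 * e * ln (2 * e / hub_kappa e u).
Proof.
move=> s; have e_lt_u := small_lt s; case: s => e0 u0 u1 eu2.
have eu0 : 0 < e * u by rewrite mulr_gt0.
have eu_e : e * u * 100 < e by rewrite -mulrA gtr_pMr.
have ee : e * e * 100 < e by rewrite -mulrA gtr_pMr //; lra.
have eeu : e * (e * u) * 100 < e * e by rewrite -mulrA ltr_pM2l.
have eeu0 : 0 < e * (e * u) by rewrite mulr_gt0.
have eeu2 : e * e * 100 * 100 < e * u ^+ 2 by rewrite -!mulrA ltr_pM2l // mulrA.
have kE : hub_kappa e u * (1 + (1 + 2 * e) * (e * u)) =
    2 * e - (1 + 2 * e) * (e * u) by rewrite /hub_kappa divfK // gt_eqF //; lra.
have d_lo : e * u < (1 + 2 * e) * (e * u) by lra.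
have d_hi : (1 + 2 * e) * (e * u) <= e * u + 2 * (e * e) by lra.
have d_hi' : (1 + 2 * e) * (e * u) * 10 < e by lra.
move: (hub_kappa e u) ((1 + 2 * e) * (e * u)) kE d_lo d_hi d_hi'.
move=> k d kE d_lo d_hi d_hi'.
have d0 : 0 < d by lra.
have k0 : 0 < k by rewrite -(pmulr_lgt0 _ (_ : 0 < 1 + d)) ?kE; lra.
have kd0 : 0 < k * d by rewrite mulr_gt0.
have k_hi : k <= 2 * e - e * u by lra.
have kd : k * d <= 2 * e * d by rewrite ler_pM2r //; lra.
have ed : e * d * 10 < e * e by rewrite -mulrA ltr_pM2l.
pose y := 20 * e - 2 * k.
have -> : 1 - 20 * e + 2 * k = 1 - y by rewrite /y; ring.
have y_le : y <= 16 * e + 2 * (e * u) + 10 * (e * e) by rewrite /y; lra.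
have y_gt0 : 0 < y by rewrite /y; lra.
have y_le20 : y <= 20 * e by rewrite /y; lra.
move: y y_le y_gt0 y_le20 => y y_le y_gt0 y_le20.
have y2 : y ^+ 2 <= 400 * (e * e).
  by rewrite (_ : 400 * (e * e) = (20 * e) ^+ 2) ?ler_sqr ?nnegrE; [|lra|lra|ring].
have l1 : - (y + 2 * y ^+ 2) <= ln (1 - y) by apply: ln1B_ge; lra.
have l2 : 16 * e - (16 * e) ^+ 2 <= ln (1 + 16 * e) by apply: ln1D_ge; lra.
(* Since k <= 2 e (1 - u/2), the ratio 2 e / k is at least 1 / (1 - u/2). *)
have l3 : u / 2 + (u / 2) ^+ 2 / 8 <= ln (2 * e / k).
  apply: (le_trans (ln_inv1B_ge (_ : 0 <= u / 2 < 1))); first by lra.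
  have h0 : 0 < 1 - u / 2 by lra.
  have e20 : 0 < 2 * e by lra.
  rewrite ler_ln ?posrE ?invr_gt0 ?divr_gt0 //.
  by rewrite ler_pdivlMr // mulrC ler_pdivrMr //; lra.
have {}l3 : e * (u / 2 + (u / 2) ^+ 2 / 8) <= e * ln (2 * e / k).
  by rewrite ler_pM2l.
lra.
Qed.

(** Without the point 3, nothing balances the decrement: the order-e terms cancel and a negative
    term of order e u remains. *)
Lemma sub_drift (R : realType) (e u : R) : small 1 e u ->
  (2^-1 - 10 * e) * ln ((1 - 20 * e) / (1 - 2 * sub_kappa e u)) +
  (2^-1 + 8 * e) * ln (1 + 16 * e) < 0.
Proof.
move=> s; have e_lt_u := small_lt s; case: s => e0 u0 u1 _.
have eu0 : 0 < e * u by rewrite mulr_gt0.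
have eu_e : e * u * 100 < e by rewrite -mulrA gtr_pMr.
have ee : e * e * 100 < e by rewrite -mulrA gtr_pMr //; lra.
have eeu : e * (e * u) * 100 < e * u by rewrite mulrAC gtr_pMl //; lra.
have eeu0 : 0 < e * (e * u) by rewrite mulr_gt0.
have eu2 : e * e * 100 * 100 < e * u by rewrite -!mulrA ltr_pM2l // mulrA.
have kE : sub_kappa e u * (1 - (1 - 2 * e) * (e * u)) =
    2 * e - (1 - 2 * e) * (e * u) by rewrite /sub_kappa divfK // gt_eqF //; lra.
have d_lo : e * u - 2 * (e * (e * u)) <= (1 - 2 * e) * (e * u) by lra.
have d_hi : (1 - 2 * e) * (e * u) < e * u by lra.
move: (sub_kappa e u) ((1 - 2 * e) * (e * u)) kE d_lo d_hi => k d kE d_lo d_hi.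
have d0 : 0 < d by lra.
have k0 : 0 < k by rewrite -(pmulr_lgt0 _ (_ : 0 < 1 - d)) ?kE; lra.
have k_hi : k < 2 * e.
  have ed : e * d * 100 < d by rewrite mulrAC gtr_pMl //; lra.
  by rewrite -(ltr_pM2r (_ : 0 < 1 - d)) ?kE; lra.
have kd : k * d <= 2 * e * (e * u).
  by apply: ler_pM; lra.
(* As k is about 2 e - e u, the left side is about - 16 e - 2 e u; one e u is given up to absorb the
   errors. *)
have k_hi' : 2 * k - 20 * e <= - 16 * e - e * u by lra.
have c0 : 0 < (1 - 20 * e) / (1 - 2 * k) by rewrite divr_gt0 //; lra.
have l1 : ln ((1 - 20 * e) / (1 - 2 * k)) <= - 16 * e - e * u.
  apply: le_trans (ln_le_subr1 c0) _; apply: le_trans _ k_hi'.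
  rewrite lerBlDr ler_pdivrMr; last lra.
  have : k * (10 * e - k) >= 0 by rewrite mulr_ge0 //; lra.
  lra.
have l2 : ln (1 + 16 * e) <= 16 * e by apply: le_ln1Dx; lra.
have {}l1 : (2^-1 - 10 * e) * ln ((1 - 20 * e) / (1 - 2 * k)) <=
    (2^-1 - 10 * e) * (- 16 * e - e * u) by rewrite ler_pM2l //; lra.
have {}l2 : (2^-1 + 8 * e) * ln (1 + 16 * e) <= (2^-1 + 8 * e) * (16 * e).
  by rewrite ler_pM2l //; lra.
lra.
Qed.


(** * The adversaries in the three models *)

Lemma tv_conclusion (R : realType) (e u : R) (ps qs : 'I_3 -> R) :
    small 3 e u -> lfd_TV (e - e * u) (p3 e) (@q3 R) ps qs ->
  exists P2 Q2 : 'I_3 -> R,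
    [/\ uncertainty TV (p3 e) e P2, uncertainty TV (@q3 R) e Q2 &
        limn_einf (fun n => (worst_error ps qs P2 Q2 n)%:E) = 1%E].
Proof.
move=> s; move/(lfd_TV_p3 _ _ s) => [psE qsE].
have e_small := small_lt20 s; have e_lt_u := small_lt s; have drift := tv_drift s.
case: (s) => e0 u0 u1 _.
have eu0 : 0 < e * u by rewrite mulr_gt0.
have eu_e : e * u * 100 < e by rewrite -mulrA gtr_pMr.
have c1_gt0 : 0 < tv_low e u by rewrite divr_gt0 //; lra.
have c2_gt0 : 0 < tv_high u by rewrite divr_gt0 //; lra.
move: (tv_low e u) (tv_high u) psE qsE drift c1_gt0 c2_gt0.
move=> c1 c2 psE qsE drift c1_gt0 c2_gt0.
have sP := simplex_p3 e_small.
(* Mass e goes from the point of lowest ratio to that of highest ratio, which uses the whole TV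
   budget; p is left uncontaminated. *)
pose Q : 'I_3 -> R := fun i => [:: 2^-1 - e; 2^-1; e]`_i.
have sQ : simplex Q by apply: simplex3; lra.
exists (p3 e), Q; split.
- split=> //; rewrite /dTV big1 ?mulr0 ?ltW // => i _.
  by rewrite subrr normr0.
- split=> //; rewrite /dTV sum_ord3 /q3 /= subrr normr0 addr0 subr0.
  have -> : 2^-1 - e - 2^-1 = - e by ring.
  by rewrite normrN gtr0_norm //; lra.
- have pos i : 0 < ps i /\ 0 < qs i.
    rewrite psE qsE; elim/ord3_ind: i => /=;
      split; rewrite ?divr_gt0 ?mulr_gt0 //; lra.
  apply: (worst_error_to1_under_Q sP sQ) => //.
  have r0 : ps i0 / qs i0 = c1.
    by rewrite psE qsE /=; field; rewrite !gt_eqF //=; lra.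
  have r1 : ps i1 / qs i1 = 1 + 16 * e by rewrite psE qsE /=; field.
  have r2 : ps i2 / qs i2 = c2.
    by rewrite psE qsE /=; field; rewrite !gt_eqF //=; lra.
  by rewrite sum_ord3 r0 r1 r2.
Qed.

Lemma hub_conclusion (R : realType) (e u : R) (ps qs : 'I_3 -> R) :
    small 2 e u ->
    lfd_Hub (2 * e / (1 + 2 * e) - e * u) (p3 e) (@q3 R) ps qs ->
  exists P2 Q2 : 'I_3 -> R,
    [/\ uncertainty Hub (p3 e) (2 * e / (1 + 2 * e)) P2,
        uncertainty Hub (@q3 R) (2 * e / (1 + 2 * e)) Q2 &
        limn_einf (fun n => (worst_error ps qs P2 Q2 n)%:E) = 1%E].
Proof.
move=> s; move/(lfd_Hub_p3 _ _ s) => [psE qsE].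
have e_small := small_lt20 s; have e_lt_u := small_lt s; have drift := hub_drift s.
case: s => e0 u0 u1 _.
have eu0 : 0 < e * u by rewrite mulr_gt0.
have eu_e : e * u * 100 < e by rewrite -mulrA gtr_pMr.
have eeu : e * (e * u) * 100 < e * u by rewrite mulrAC gtr_pMl //; lra.
have eeu0 : 0 < e * (e * u) by rewrite mulr_gt0.
have k_gt0 : 0 < hub_kappa e u by rewrite divr_gt0 //; lra.
have c1_gt0 : 0 < 1 - 20 * e + 2 * hub_kappa e u by lra.
have c2_gt0 : 0 < 2 * e / hub_kappa e u by rewrite divr_gt0 //; lra.
have E0 : 0 < 1 + 2 * e by lra.
set eps := 2 * e / (1 + 2 * e) in psE qsE *.
have epsE : eps * (1 + 2 * e) = 2 * e by rewrite /eps divfK // gt_eqF.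
have eps_gt0 : 0 < eps by rewrite /eps divr_gt0 //; lra.
have eps_le : eps <= 2 * e by rewrite /eps ler_pdivrMr //; nra.
move: (hub_kappa e u) (2 * e / hub_kappa e u) eps psE qsE k_gt0 c1_gt0 c2_gt0
  drift epsE eps_gt0 eps_le.
move=> k c2 eps psE qsE k_gt0 c1_gt0 c2_gt0 drift epsE eps_gt0 eps_le.
have sP := simplex_p3 e_small.
have eta_lt1 : 0 < 1 - (eps - e * u) by lra.
(* The contamination of q is the point mass at 3. *)
pose Q : 'I_3 -> R := fun i => [:: (1 - eps) / 2; (1 - eps) / 2; eps]`_i.
have sQ : simplex Q by apply: simplex3; lra.
exists (p3 e), Q; split.
- by exists (p3 e) => // x; ring.
- exists (fun i : 'I_3 => [:: 0; 0; 1]`_i); first by apply: simplex3; lra.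
  by apply: ord3_ind; rewrite /Q /q3 /=; ring.
- have pos i : 0 < ps i /\ 0 < qs i.
    rewrite psE qsE; elim/ord3_ind: i => /=;
      split; rewrite ?divr_gt0 ?mulr_gt0 //; lra.
  apply: (worst_error_to1_under_Q sP sQ) => //.
  have r0 : ps i0 / qs i0 = 1 - 20 * e + 2 * k.
    by rewrite psE qsE /=; field; rewrite gt_eqF.
  have r1 : ps i1 / qs i1 = 1 + 16 * e.
    by rewrite psE qsE /=; field; rewrite gt_eqF.
  have r2 : ps i2 / qs i2 = c2.
    by rewrite psE qsE /=; field; rewrite !gt_eqF.
  rewrite sum_ord3 r0 r1 r2 /Q /=.
  (* Since eps = (1 - eps) 2 e, the mean under Q is 1 - eps times the expression of [hub_drift]. *)
  have epsQ : eps * ln c2 = (1 - eps) * (2 * e) * ln c2.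
    by congr (_ * _); lra.
  have h : 0 < 1 - eps by lra.
  by have := mulr_gt0 h drift; lra.
Qed.

Lemma sub_conclusion (R : realType) (e u : R) (ps qs : 'I_3 -> R) :
    small 1 e u ->
    lfd_Sub (2 * e / (1 - 2 * e) - e * u) (p3 e) (@q3 R) ps qs ->
  exists P2 Q2 : 'I_3 -> R,
    [/\ uncertainty Defs.Sub (p3 e) (2 * e / (1 - 2 * e)) P2,
        uncertainty Defs.Sub (@q3 R) (2 * e / (1 - 2 * e)) Q2 &
        limn_einf (fun n => (worst_error ps qs P2 Q2 n)%:E) = 1%E].
Proof.
move=> s; move/(lfd_Sub_p3 _ _ s) => [psE qsE].
have e_small := small_lt20 s; have e_lt_u := small_lt s; have drift := sub_drift s.
case: s => e0 u0 u1 _.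
have eu0 : 0 < e * u by rewrite mulr_gt0.
have eu_e : e * u * 100 < e by rewrite -mulrA gtr_pMr.
have eeu : e * (e * u) * 100 < e * u by rewrite mulrAC gtr_pMl //; lra.
have eeu0 : 0 < e * (e * u) by rewrite mulr_gt0.
have k_lt : sub_kappa e u < 4^-1 by rewrite /sub_kappa ltr_pdivrMr; lra.
have c1_gt0 : 0 < (1 - 20 * e) / (1 - 2 * sub_kappa e u).
  by rewrite divr_gt0 //; lra.
have E0 : 0 < 1 - 2 * e by lra.
set eps := 2 * e / (1 - 2 * e) in psE qsE *.
have epsE : 1 + eps = (1 - 2 * e)^-1 by rewrite /eps; field; rewrite gt_eqF.
have eps_gt0 : 0 < eps by rewrite /eps divr_gt0 //; lra.
have eps_ge : 2 * e <= eps by rewrite /eps ler_pdivlMr //; nra.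
move: ((1 - 20 * e) / _) eps psE qsE c1_gt0 drift epsE eps_gt0 eps_ge.
move=> c1 eps psE qsE c1_gt0 drift epsE eps_gt0 eps_ge.
have sQ := simplex_q3 R.
have eta_gt : 0 < 1 + (eps - e * u) by lra.
pose a := (1 - 2 * e)^-1.
have a_gt0 : 0 < a by rewrite invr_gt0.
(* This is p conditioned on {1, 2}. Its factor 1 / (1 - 2 e) equals 1 + [eps2], so the Sub
   constraint is attained at both points. *)
pose P : 'I_3 -> R :=
  fun i => [:: a * (2^-1 - 10 * e); a * (2^-1 + 8 * e); 0]`_i.
have sP : simplex P.
  apply: simplex3; rewrite ?mulr_ge0 //; try lra.
  by rewrite /a; field; rewrite gt_eqF.
exists P, (@q3 R); split.
- split=> //; rewrite epsE -/a; apply: ord3_ind; rewrite /P /p3 //=.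
  by rewrite !mulr_ge0 //; lra.
- split=> //; apply: ord3_ind; rewrite /q3 /=; lra.
(* [qs] vanishes at 3, but P gives that point no mass, so positivity is needed only at 1 and 2. *)
- apply: (worst_error_to1_under_P sP sQ) => //.
    apply: ord3_ind; rewrite psE qsE /P /= ?eqxx // => _;
      split; rewrite ?mulr_gt0 ?invr_gt0 //; lra.
  have r0 : qs i0 / ps i0 = c1^-1.
    rewrite psE qsE /=; field; rewrite !gt_eqF //; lra.
  have r1 : qs i1 / ps i1 = (1 + 16 * e)^-1.
    rewrite psE qsE /=; field; rewrite !gt_eqF //; lra.
  rewrite sum_ord3 r0 r1 !lnV ?posrE //; last by lra.
  rewrite /P /= mul0r addr0 !mulrN -!mulrA -opprD -mulrDr oppr_gt0.
  by rewrite pmulr_rlt0.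
Qed.

(** * Passage to small e and assembly of the three models *)

Lemma near_small (R : realType) (t : R) (k : nat) : 0 < t -> k%:R * t < 1 ->
  \forall e \near (0 : R)^'+, small k e (e `^ t).
Proof.
move=> t0 kt; have d0 : 0 < 100^-1 / 100 :> R by lra.
apply: filterS (near_powR_small t0 kt d0) => e [e0 u0 u1 eu].
split=> //; [|move: (_ ^+ k) eu => x]; lra.
Qed.

Theorem theorem5p1 (R : realType) (A : model) (t : R)
    (t_gt0 : 0 < t) (t_lt : t < tmax R A) :
  (eps1 A t = @eps2 R A +o_ ((0 : R)^'+) (@eps2 R A)) /\
  (\forall e \near (0 : R)^'+,
     [/\ simplex (p3 e), simplex (@q3 R), eps1 A t e < eps2 A e,
         (exists ps qs : 'I_3 -> R, lfd A (eps1 A t e) (p3 e) (@q3 R) ps qs) &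
         forall ps qs : 'I_3 -> R, lfd A (eps1 A t e) (p3 e) (@q3 R) ps qs ->
           exists P2 Q2 : 'I_3 -> R,
             [/\ uncertainty A (p3 e) (eps2 A e) P2,
                 uncertainty A (@q3 R) (eps2 A e) Q2 &
                 limn_einf (fun n => (worst_error ps qs P2 Q2 n)%:E) = 1%E]]).
Proof.
split; first exact: eps1_eqo.
have eps1E e : 0 < e -> eps1 A t e = eps2 A e - e * e `^ t.
  by move=> e0; rewrite /eps1 powR1D.
have eps_lt e : 0 < e -> eps1 A t e < eps2 A e.
  by move=> e0; rewrite eps1E // gtrBl mulr_gt0 ?powR_gt0.
case: A t_lt eps1E eps_lt => /= t_lt eps1E eps_lt.
- have kt : 3%:R * t < 1 by lra.
  apply: filterS (near_small t_gt0 kt) => e s; have [e0 _ _ _] := s.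
  have e_small := small_lt20 s.
  split; [exact: simplex_p3 | exact: simplex_q3 | exact: eps_lt | |].
    (* The closed forms themselves serve as the pair: reflexivity instantiates the two witnesses. *)
    eexists; eexists; rewrite eps1E //; apply/(lfd_TV_p3 _ _ s); split;
      by move=> i; reflexivity.
  by move=> ps qs; rewrite eps1E //; exact: tv_conclusion.
- have kt : 2%:R * t < 1 by lra.
  apply: filterS (near_small t_gt0 kt) => e s; have [e0 _ _ _] := s.
  have e_small := small_lt20 s.
  split; [exact: simplex_p3 | exact: simplex_q3 | exact: eps_lt | |].
    eexists; eexists; rewrite eps1E //; apply/(lfd_Hub_p3 _ _ s); split;
      by move=> i; reflexivity.
  by move=> ps qs; rewrite eps1E //; exact: hub_conclusion.
- have kt : 1%:R * t < 1 by lra.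
  apply: filterS (near_small t_gt0 kt) => e s; have [e0 _ _ _] := s.
  have e_small := small_lt20 s.
  split; [exact: simplex_p3 | exact: simplex_q3 | exact: eps_lt | |].
    eexists; eexists; rewrite eps1E //; apply/(lfd_Sub_p3 _ _ s); split;
      by move=> i; reflexivity.
  by move=> ps qs; rewrite eps1E //; exact: sub_conclusion.
Qed.
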